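(* Let $n\geqslant 2$ and let $\iota:S_n\to S_n$ be an involution such that $\mathrm{maj}=\ell\circ\iota$ on $S_n$ (such an involution is known to exist). Then there exists an involution $\tilde\iota:S_n^B\to S_n^B$ such that $$\mathrm{nmaj}=\ell_B\circ\tilde\iota,$$ and this involution satisfies $\tilde\iota(\sigma)=P^J(\sigma)\,\iota(\sigma_J)$ for all $\sigma\in S_n^B$.
   Context: $S_n^B$ is the group of bijections $w$ of $[\pm n]=\{-n,\dots,-1,1,\dots,n\}$ with $w(-a)=-w(a)$, written as sequences $(w(1),\dots,w(n))$; it is a Coxeter group with generators $s_0=(-1,2,\dots,n)$ and $s_i=(1,\dots,i-1,i+1,i,i+2,\dots,n)$ for $1\le i\le n-1$, with length $\ell_B$. Let $J=\{s_1,\dots,s_{n-1}\}$; the symmetric group $S_n$ is identified with the parabolic subgroup generated by $J$, and $\ell$ is the Coxeter length of $S_n$ (number of inversions). Each $\sigma\in S_n^B$ factors uniquely as $\sigma=\sigma^J\sigma_J$ with $\sigma_J\in S_n$, $\sigma^J\in\{w:\ell_B(ws)>\ell_B(w)\ \forall s\in J\}$ and $\ell_B(\sigma)=\ell_B(\sigma^J)+\ell_B(\sigma_J)$; $P^J(\sigma):=\sigma^J$. For a sequence $\sigma=(\sigma(1),\dots,\sigma(n))$ of integers, $\mathrm{maj}(\sigma)=\sum_{i\in[n-1],\,\sigma(i)>\sigma(i+1)}i$ and $\mathrm{Neg}(\sigma)=\{i\in[n]:\sigma(i)<0\}$. The negative major index is $\mathrm{nmaj}(\sigma)=\mathrm{maj}(\sigma)-\sum_{i\in\mathrm{Neg}(\sigma)}\sigma(i)$.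 An involution is a map of sets whose square is the identity. *)

(* Defs.v *)
From HB Require Import structures.
From mathcomp Require Import all_boot all_order all_algebra all_fingroup.
From mathcomp Require Import zify.

Set Implicit Arguments.
Unset Strict Implicit.
Unset Printing Implicit Defensive.

Import Order.TTheory GRing.Theory Num.Theory.
Import GroupScope.

(* MathComp multiplies permutations left to right, (s * t) x = t (s x).
   [compg u v] is the product u v of the usual convention "first v, then u". *)
Definition compg (gT : finGroupType) (u v : gT) : gT := v * u.

Section WordLength.
Variable gT : finGroupType.
Implicit Types (S : {set gT}) (w : gT).

(* [S ^+ k] is the set of all products of k elements of S, so this is the least
   k such that w is a product of k elements of S, for every w in <<S>> (see
   wlen_mem, wlen_min).  It does not depend on the order in which products are
   taken, since reversing words preserves their length. *)
Definition wlen S w : nat := find (fun k => w \in S ^+ k) (iota 0 #|gT|).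

Lemma wlen_bound S w : w \in <<S>> -> exists2 k, k < #|gT| & w \in S ^+ k.
Proof.
case/gen_prodgP=> m0 [c0 c0S w0].
have ex : exists k, w \in S ^+ k.
  exists m0; rewrite w0; elim: m0 c0 c0S {w0} => [|m IH] c cS.
    by rewrite big_ord0 expg0 inE.
  by rewrite big_ord_recl expgS mem_mulg ?IH.
case: (ex_minnP ex) => k wk kmin; exists k => //.
have [s [ss sS ws]] : exists s : seq gT,
    [/\ size s = k, all (mem S) s & w = \prod_(x <- s) x].
  elim: k w wk {ex kmin w0} => [|k IH] w.
    by rewrite expg0 => /set1P->; exists [::]; rewrite big_nil.
  rewrite expgS => /mulsgP [x y xS /IH [s [ss sS ->]] ->].
  by exists (x :: s); rewrite /= ss xS sS big_cons.
have memS (t : seq gT) : all (mem S) t -> \prod_(x <- t) x \in S ^+ size t.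
  elim: t => [|x t IH] /=; first by rewrite big_nil expg0 inE.
  by case/andP=> xS tS; rewrite big_cons expgS mem_mulg ?IH.
pose f (i : 'I_k.+1) := \prod_(x <- take i s) x.
suff /leq_card : injective f by rewrite card_ord.
have main (i j : 'I_k.+1) : f i = f j -> i < j -> False.
  move=> fij ltij.
  have wE : w = \prod_(x <- take i s ++ drop j s) x.
    by rewrite big_cat /= -/(f i) fij /f -big_cat /= cat_take_drop.
  have aS : all (mem S) (take i s ++ drop j s).
    move: (sS); rewrite -{1}(cat_take_drop i s) all_cat => /andP[a1 _].
    by move: sS; rewrite all_cat a1 -{1}(cat_take_drop j s) all_cat => /andP[].
  have := kmin _ (_ : w \in S ^+ size (take i s ++ drop j s)).
  rewrite {1}wE => /(_ (memS _ aS)).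
  have jk : j <= k by rewrite -ltnS.
  rewrite size_cat size_take size_drop ss (leq_trans ltij jk).
  by rewrite leqNgt addnBA // ltn_subLR ?ltn_add2r ?ltij // (leq_trans jk (leq_addl _ _)).
move=> i j fij; apply: val_inj => /=.
by case: (ltngtP i j) => // lt; case: (main _ _ _ lt).
Qed.

Lemma wlen_mem S w : w \in <<S>> -> w \in S ^+ wlen S w.
Proof.
case/wlen_bound=> k ltk wk.
have hs : has (fun k => w \in S ^+ k) (iota 0 #|gT|).
  by apply/hasP; exists k; rewrite ?mem_iota.
have := nth_find 0 hs; rewrite nth_iota //.
by move: hs; rewrite has_find size_iota.
Qed.

Lemma wlen_min S w k : w \in S ^+ k -> wlen S w <= k.
Proof.
move=> wk; rewrite /wlen leqNgt; apply/negP => ltk.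
have := before_find 0 ltk; rewrite nth_iota ?wk //.
by apply: leq_trans ltk _; rewrite -{2}(size_iota 0 #|gT|) find_size.
Qed.

End WordLength.

Section SignedPermutations.
Variable n : nat.

(* The pair (i, b) encodes the element (-1)^b (i + 1) of [+-n]: indices are
   shifted by one, as 'I_n is {0, ..., n-1}. *)
Definition letter : finType := ('I_n * bool)%type.
Definition oppl (a : letter) : letter := (a.1, ~~ a.2).
Definition posl (i : 'I_n) : letter := (i, false).
Definition valz (a : letter) : int := ((-1) ^+ a.2 * (a.1.+1)%:Z)%R.

Definition signed_perm : {set {perm letter}} :=
  [set w : {perm letter} | [forall a, w (oppl a) == oppl (w a)]].

Lemma signed_perm_group_set : group_set signed_perm.
Proof.
apply/group_setP; split=> [|u v].
  by rewrite inE; apply/forallP=> a; rewrite !perm1.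
rewrite !inE => /forallP uP /forallP vP; apply/forallP=> a.
by rewrite !permM (eqP (uP a)) (eqP (vP _)).
Qed.
Canonical signed_perm_group := Group signed_perm_group_set.

Definition SB : finGroupType := subg_of signed_perm_group.

(* The integer w(i), for i in [n]. *)
Definition ev (w : SB) (i : 'I_n) : int := valz (sgval w (posl i)).

Definition embf (v : 'S_n) (a : letter) : letter := (v a.1, a.2).

Lemma embf_inj v : injective (embf v).
Proof. by move=> [i b] [j c] [/perm_inj -> ->]. Qed.

Lemma emb_signed v : perm (@embf_inj v) \in signed_perm_group.
Proof. by rewrite inE; apply/forallP=> a; rewrite !permE. Qed.

(* The identification of S_n with the parabolic subgroup <<J>> of S_n^B, see
   embM and emb_parabolic below. *)
Definition emb (v : 'S_n) : SB := Subg (emb_signed v).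

Lemma flip_signed (i : 'I_n) :
  tperm (posl i) (oppl (posl i)) \in signed_perm_group.
Proof.
rewrite inE; apply/forallP=> -[j b]; rewrite !permE /= /oppl /posl /=.
by rewrite !xpair_eqE; case: (j =P i) => [->|]; case: b.
Qed.

Definition flip (i : 'I_n) : SB := Subg (flip_signed i).

Definition simpleA : {set 'S_n} :=
  [set tperm p.1 p.2 | p : 'I_n * 'I_n & (p.2 == p.1.+1 :> nat)].

(* J = {s_1, ..., s_(n-1)} *)
Definition J : {set SB} := emb @: simpleA.

Lemma embM : {morph emb : u v / u * v}.
Proof.
by move=> u v; apply/val_inj/permP => a; rewrite permM !permE /embf /= permM.
Qed.

Lemma gen_simpleA : <<simpleA>> = [set: 'S_n].
Proof.
apply/eqP; rewrite -subTset; apply/subsetP=> v _.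
have main k (i j : 'I_n) : j = i + k.+1 :> nat -> tperm i j \in <<simpleA>>.
  elim: k i j => [|k IH] i j ij.
    apply/mem_gen/imsetP; exists (i, j) => //.
    by rewrite inE /= ij addn1.
  have lt : i.+1 < n by apply: leq_ltn_trans (ltn_ord j); rewrite ij; lia.
  pose h := Ordinal lt.
  have hj : tperm h j \in <<simpleA>> by apply: IH; rewrite ij /=; lia.
  have ih : tperm i h \in <<simpleA>>.
    by apply/mem_gen/imsetP; exists (i, h); rewrite ?inE.
  have <- : tperm h j ^ tperm i h = tperm i j.
    rewrite tpermJ tpermR tpermD //; apply/eqP => /(congr1 val) /=; lia.
  by rewrite groupJ.
have [ts -> _] := prod_tpermP v.
apply: group_prod => -[i j] _ /=.
case: (ltngtP i j) => [lt|lt|/val_inj->]; last by rewrite tperm1 group1.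
- by apply: (main (j - i).-1); lia.
- by rewrite tpermC; apply: (main (i - j).-1); lia.
Qed.

Lemma emb_parabolic : emb @: [set: 'S_n] = <<J>>.
Proof.
pose f := Morphism (in2W embM : {in [set: 'S_n] &, {morph emb : u v / u * v}}).
have := morphim_gen f (subsetT simpleA).
by rewrite gen_simpleA !morphimEsub ?subsetT.
Qed.

(* J together with s_0 *)
Definition simpleB : {set SB} := [set flip i | i : 'I_n & (i == 0 :> nat)] :|: J.

Definition lenA (v : 'S_n) : nat := wlen simpleA v.
Definition lenB (w : SB) : nat := wlen simpleB w.

Definition minrep : {set SB} :=
  [set w | [forall s in J, lenB w < lenB (compg w s)]].

Definition parabolic_fact (s : SB) (uv : SB * 'S_n) : bool :=
  [&& s == compg uv.1 (emb uv.2), uv.1 \in minrep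
    & lenB s == lenB uv.1 + lenB (emb uv.2)].

(* Such a factorization exists and is unique, so the default is never used. *)
Definition parabolic_pair (s : SB) : SB * 'S_n :=
  odflt (s, 1) [pick uv | parabolic_fact s uv].

Definition PJ (s : SB) : SB := (parabolic_pair s).1.
Definition partJ (s : SB) : 'S_n := (parabolic_pair s).2.

(* s lists s(1), s(2), ..., so that s(i) is the entry of index i - 1. *)
Definition maj (s : seq int) : nat :=
  \sum_(1 <= i < size s | (s`_i < s`_i.-1)%R) i.

Definition windowA (v : 'S_n) : seq int := [seq ((v i).+1)%:Z%R | i : 'I_n].
Definition windowB (w : SB) : seq int := [seq ev w i | i : 'I_n].

Definition Neg (w : SB) : {set 'I_n} := [set i | (ev w i < 0)%R].

Definition nmaj (w : SB) : int :=
  ((maj (windowB w))%:Z - \sum_(i in Neg w) ev w i)%R.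

End SignedPermutations.

(* Main.v *)
Require Import Defs.
From HB Require Import structures.
From mathcomp Require Import all_boot all_order all_algebra all_fingroup.
From mathcomp Require Import zify.

Set Implicit Arguments.
Unset Strict Implicit.
Unset Printing Implicit Defensive.

Import Order.TTheory GRing.Theory Num.Theory.
Import GroupScope.

(** Right multiplication by an element of J permutes the entries of the window
    (w(1), ..., w(n)) of a signed permutation w, so w = u v with v in S_n and u
    the element whose window is that of w sorted increasingly.  Everything
    rests on two observations about such a product.

    - The entries of the window of u v are those of u, in the relative order
      of v.  Hence maj and the number of inversions of that window are those
      of v, and the sum of the absolute values of the negative entries,
      written negsum, depends on u only.

    - The length of w is the number of inversions of its window plus negsum
      (lenB_statB), and the length in S_n is the number of inversions
      (lenA_invs).

    So the length of u v is negsum u + lenA v (lenB_fact) while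
    nmaj (u v) = negsum u + maj v (nmaj_fact): an involution of S_n that turns
    maj into the length turns nmaj into lenB when it is applied to the factor
    v alone.  The length formula also shows that the minimal coset
    representatives are the w with an increasing window (minrepE), so that
    the product above is the parabolic factorization (parabolic_pairE); the
    map is an involution because it leaves the factor u unchanged. *)

(** * Recognizing a word length *)

(** A statistic is the word length as soon as it vanishes at the identity,
    grows by at most one along each generator, and decreases along some
    generator at every other element: the second condition makes it a lower
    bound for the length of a word, and iterating the third produces a word
    that attains it. *)
Lemma wlen_eq (gT : finGroupType) (S : {set gT}) (L : gT -> nat) :
    L 1 = 0 ->
    (forall s w, s \in S -> L (compg w s) <= (L w).+1) ->
    (forall w, w != 1 ->
       exists s w', [/\ s \in S, w = compg w' s & L w' < L w]) ->
  forall w, wlen S w = L w.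
Proof.
move=> L1 Lup Ldown w.
have memL x : x \in S ^+ L x.
  have [m] := ubnP (L x); elim: m x => // m IHm x lt_m.
  have [-> | /Ldown[s [x' [sS xE lt_x]]]] := eqVneq x 1; first by rewrite L1 inE.
  have -> : L x = (L x').+1.
    by apply/eqP; rewrite eqn_leq lt_x andbT {1}xE Lup.
  by rewrite expgS {1}xE mem_mulg // IHm // (leq_trans lt_x).
have minL k : forall x, x \in S ^+ k -> L x <= k.
  elim: k => [|k IHk] x; first by rewrite expg0 => /set1P->; rewrite L1.
  rewrite expgS => /mulsgP[s y sS /IHk le_y ->].
  by apply: leq_trans (Lup s y sS) _.
apply/eqP; rewrite eqn_leq wlen_min //=; apply/minL/wlen_mem.
have memS k : forall x, x \in S ^+ k -> x \in <<S>>.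
  elim: k => [|k IHk] x; first by rewrite expg0 => /set1P->; rewrite group1.
  by rewrite expgS => /mulsgP[s y sS /IHk yS ->]; rewrite groupM // mem_gen.
exact: memS (memL w).
Qed.

(** * Inversions of a finite sequence *)

Section Inversions.
Variable n : nat.
Implicit Types (f g : 'I_n -> int) (v : 'S_n) (i j : 'I_n).

Definition invset f : {set 'I_n * 'I_n} :=
  [set p : 'I_n * 'I_n | (p.1 < p.2) && (f p.2 < f p.1)%R].
Definition invs f : nat := #|invset f|.

Definition increasing f := forall i j : 'I_n, i < j -> (f i < f j)%R.

Definition same_order f g := forall i j, (f i < f j)%R = (g i < g j)%R.

Lemma eq_invs f g : same_order f g -> invs f = invs g.
Proof. by move=> fg; apply: eq_card => p; rewrite !inE fg. Qed.

Lemma invs_increasing f : increasing f -> invs f = 0.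
Proof.
move=> fI; apply: eq_card0 => p; rewrite !inE.
by case: (ltnP p.1 p.2) => //= /fI; lia.
Qed.

(** An adjacent transposition moves no other letter across i or j, so it
    reverses the order of the positions i and j only. *)
Lemma ltn_tperm i j a b : j = i.+1 :> nat ->
    (a, b) != (i, j) -> (a, b) != (j, i) ->
  (tperm i j a < tperm i j b) = (a < b).
Proof.
move=> ij; rewrite !xpair_eqE -!val_eqE /=.
by case: tpermP => [->|->|/eqP + /eqP]; case: tpermP => [->|->|/eqP + /eqP];
  rewrite -?val_eqE /=; lia.
Qed.

(** Carrying each pair of positions along the transposition identifies the
    inversions after the swap with the old ones and the pair of swapped
    positions. *)
Lemma invs_swap f i j : j = i.+1 :> nat -> (f i < f j)%R ->
  invs (f \o tperm i j) = (invs f).+1.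
Proof.
move=> ij fij; set s := tperm i j.
pose ss (p : 'I_n * 'I_n) := (s p.1, s p.2).
have ssK : involutive ss by case=> a b; rewrite /ss /= !tpermK.
have ji : j < i = false by lia.
have -> : invs (f \o s) = #|(j, i) |: invset f|.
  (* (j, i) is not a pair of increasing positions: it is the image under ss
     of the new inversion (i, j) *)
  rewrite /invs -[LHS](card_imset _ (inv_inj ssK)); apply: eq_card => p.
  rewrite -[p in LHS]ssK (mem_imset _ _ (inv_inj ssK)).
  case: p => a b; rewrite !inE /= !tpermK.
  have [[-> ->] | ne_ji] := altP ((a, b) =P (j, i)).
    by rewrite tpermL tpermR fij ij leqnn.
  have [[-> ->] | ne_ij] := altP ((a, b) =P (i, j)).
    by rewrite tpermL tpermR ji ltNge (ltW fij) /= andbF.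
  by rewrite ltn_tperm.
by rewrite cardsU1 inE /= ji.
Qed.

Lemma invs_swap_descent f i j : j = i.+1 :> nat -> (f j < f i)%R ->
  invs f = (invs (f \o tperm i j)).+1.
Proof.
move=> ij fji; rewrite -(@invs_swap _ i j) //=; last by rewrite tpermL tpermR.
by apply: eq_invs => a b /=; rewrite !tpermK.
Qed.

Lemma invs_swap_le f i j : injective f -> j = i.+1 :> nat ->
  invs (f \o tperm i j) <= (invs f).+1.
Proof.
move=> f_inj ij; have [fij|fji|/f_inj ij'] := ltgtP (f i) (f j).
- by rewrite invs_swap.
- by rewrite (invs_swap_descent ij fji) ltnW.
- by move: ij; rewrite ij'; lia.
Qed.

Lemma increasing_adj f :
  (forall i j, j = i.+1 :> nat -> (f i < f j)%R) -> increasing f.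
Proof.
move=> fS i j; have [k] := ubnP (j - i)%N; elim: k i j => // k IHk i j lt_k ij.
have lt_n : i.+1 < n by apply: leq_ltn_trans (ltn_ord j).
pose h := Ordinal lt_n; have fih : (f i < f h)%R by apply: fS.
have [hj | jh | hj] := ltngtP h j; last by rewrite -(val_inj hj).
- by apply: lt_trans fih _; apply: IHk => //=; lia.
- by move: jh => /=; lia.
Qed.

Lemma increasingVdescent f : injective f ->
  increasing f \/ exists i j, j = i.+1 :> nat /\ (f j < f i)%R.
Proof.
move=> f_inj.
have [/existsP[i /existsP[j /andP[/eqP ij fji]]] | noD] :=
  boolP [exists i : 'I_n, exists j : 'I_n, (j == i.+1 :> nat) && (f j < f i)%R].
  by right; exists i, j.
left; apply: increasing_adj => i j ij; rewrite lt_neqAle leNgt; apply/andP; split.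
  by apply/eqP => /f_inj ij'; move: ij; rewrite ij'; lia.
apply: contra noD => fji; apply/existsP; exists i; apply/existsP; exists j.
by rewrite ij eqxx.
Qed.

Lemma card_ltn_ord i : #|[set j : 'I_n | j < i]| = i.
Proof.
have widen_inj : injective (widen_ord (ltnW (ltn_ord i))).
  by move=> j k /(congr1 val) /= /val_inj.
rewrite -[RHS]card_ord -[RHS](card_imset _ widen_inj).
apply: eq_card => j; rewrite !inE; apply/idP/imsetP => [ji | [k _ ->] //=].
by exists (Ordinal ji) => //; apply: val_inj.
Qed.

Lemma card_ltn_perm v i : #|[set j : 'I_n | v j < v i]| = v i.
Proof.
rewrite -[RHS]card_ltn_ord -[LHS](card_imset _ (@perm_inj _ v)).
apply: eq_card => j; rewrite -[j](permKV v) (mem_imset _ _ (@perm_inj _ v)).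
by rewrite !inE permKV.
Qed.

(** An increasing permutation preserves the number of elements below i, and
    this number is i itself. *)
Lemma increasing_perm1 v : (forall i j, i < j -> v i < v j) -> v = 1.
Proof.
move=> vI; have vE i j : (v i < v j) = (i < j).
  case: (ltngtP i j) => [/vI // | /vI | /val_inj->]; last by rewrite ltnn.
  by lia.
apply/permP => i; rewrite perm1; apply: val_inj => /=.
by rewrite -(card_ltn_perm v) -(card_ltn_ord i); apply: eq_card => j; rewrite !inE vE.
Qed.

(** An arrangement with the fewest inversions has no descent, as swapping at a
    descent would remove one. *)
Lemma sort_perm f : injective f ->
  exists v : 'S_n, increasing (f \o v).
Proof.
move=> f_inj; pose v := [arg min_(v < (1 : 'S_n)) invs (f \o v)].
exists v; have fv_inj : injective (f \o v) by apply: inj_comp f_inj perm_inj.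
have [// | [i [j [ij]]]] := increasingVdescent fv_inj.
rewrite /v; case: arg_minnP => // u _ u_min lt_ji.
have := u_min (tperm i j * u) isT; rewrite (invs_swap_descent ij lt_ji).
rewrite (@eq_invs (f \o (tperm i j * u)%g) (f \o u \o tperm i j)) ?ltnn // => a b.
by rewrite /= !permM.
Qed.

Definition entryA v (i : 'I_n) : int := ((v i).+1)%:Z%R.

Lemma entryA_inj v : injective (entryA v).
Proof. by move=> i j [] /val_inj/perm_inj. Qed.

Lemma lenA_invs v : lenA v = invs (entryA v).
Proof.
have entryAM w i j : same_order (entryA (compg w (tperm i j))) (entryA w \o tperm i j).
  by move=> a b; rewrite /entryA /compg /= !permM.
apply: (@wlen_eq _ _ (fun v => invs (entryA v))) => [|s w|w w1].
- by apply: invs_increasing => i j; rewrite /entryA !perm1; lia.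
- move=> /imsetP[[i j]]; rewrite inE /= => /eqP ij ->.
  by rewrite (eq_invs (entryAM w i j)) invs_swap_le //; apply: entryA_inj.
- have [wI | [i [j [ij lt_ji]]]] := increasingVdescent (@entryA_inj w).
    case/eqP: w1; apply: increasing_perm1 => i j /wI; rewrite /entryA; lia.
  exists (tperm i j), (compg w (tperm i j)); split.
  + by apply/imsetP; exists (i, j); rewrite ?inE //= ij.
  + by rewrite /compg mulgA tperm2 mul1g.
  + by rewrite (eq_invs (entryAM w i j)) [X in _ < X](invs_swap_descent ij).
Qed.

End Inversions.

(** * Changing the sign of the first entry *)

Section Negation.
Variable n : nat.
Implicit Types (f g : 'I_n -> int) (v : 'S_n) (i j : 'I_n).

Definition negsum f : nat := \sum_(i | (f i < 0)%R) `|f i|.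
Definition negate_at i0 f i : int := (if i == i0 then - f i else f i)%R.

Lemma negsum_comp f v : negsum (f \o v) = negsum f.
Proof. by rewrite /negsum [RHS](reindex_inj (@perm_inj _ v)). Qed.

Lemma negsumE f : (- \sum_(i | f i < 0) f i)%R = (negsum f)%:Z%R.
Proof.
rewrite -sumrN /negsum (big_morph Posz PoszD erefl).
by apply: eq_bigr => i; lia.
Qed.

Lemma negsum_negate f i0 : (0 < f i0)%R ->
  negsum (negate_at i0 f) = negsum f + `|f i0|.
Proof.
move=> f0; rewrite /negsum !(big_mkcond (fun i => _ < _)%R) /=.
rewrite (bigD1 i0) // [in RHS](bigD1 i0) //= /negate_at eqxx.
have -> : (f i0 < 0)%R = false by lia.
have -> : (- f i0 < 0)%R by lia.
rewrite add0n abszN addnC; congr (_ + _).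
by apply: eq_bigr => i /negbTE->.
Qed.

(** Write c > 0 for the first entry.  Every other inversion is unaffected by
    the change of sign, while the pair of the first position and j is an
    inversion if f j < c before it and if f j < - c after it.  The inversions
    that disappear are thus those with - c < f j < c; distinctness of the
    absolute values excludes f j = - c. *)
Lemma invs_negate f i0 : injective (fun i => `|f i|) ->
    i0 = 0 :> nat -> (0 < f i0)%R ->
  invs f = invs (negate_at i0 f) + #|[set j | `|f j| < `|f i0|]|.
Proof.
move=> f_inj i0E f0; set C := [set j | _].
have pair_inj : injective (fun j : 'I_n => (i0, j)) by move=> ? ? [].
rewrite -(card_imset C pair_inj) /invs -cardsUI.
rewrite (_ : _ :&: _ = set0) ?cards0 ?addn0; last first.
  apply/setP => -[a b]; rewrite !inE; apply/negbTE/negP.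
  case/andP=> /andP[/= lt_ab] + /imsetP[j + [ea eb]].
  rewrite ea in lt_ab *; rewrite -eb inE /negate_at eqxx.
  by case: eqP => [bi|_]; [rewrite bi ltnn in lt_ab | lia].
apply: eq_card => -[a b]; rewrite !inE /= /negate_at.
have [-> | ne_a] := eqVneq a i0; last first.
  rewrite (_ : (a, b) \in _ = false) ?orbF; last first.
    by apply/negbTE/negP => /imsetP[j _ [ea _]]; rewrite ea eqxx in ne_a.
  by have [-> | //] := eqVneq b i0; rewrite i0E.
rewrite (mem_imset _ _ pair_inj) inE.
have [-> | ne_b] := eqVneq b i0; first by rewrite !ltnn.
have ne_f : `|f b| <> `|f i0| by move=> /f_inj/eqP; rewrite (negbTE ne_b).
have -> : i0 < b by move: ne_b; rewrite -val_eqE /=; lia.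
by rewrite /=; lia.
Qed.

End Negation.

(** * The length of a signed permutation *)

Section Signed.
Variable n : nat.
Implicit Types (w u : SB n) (v : 'S_n) (i j : 'I_n).

Definition statB w : nat := invs (ev w) + negsum (ev w).

Lemma absz_valz (a : letter n) : `|valz a| = a.1.+1.
Proof. by rewrite /valz abszM abszX /= exp1n mul1n. Qed.

Lemma valz_inj : injective (@valz n).
Proof.
move=> [i b] [j c] e; have /(congr1 absz) := e; rewrite !absz_valz => -[/val_inj/= ij].
move: e; rewrite ij /valz /=; case: b; case: c => //; lia.
Qed.

Lemma valz_oppl (a : letter n) : valz (oppl a) = (- valz a)%R.
Proof. by case: a => i []; rewrite /valz /=; lia. Qed.

Lemma sgval_oppl w a : sgval w (oppl a) = oppl (sgval w a).
Proof. by have := subgP w; rewrite inE => /forallP/(_ a)/eqP. Qed.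

Lemma ev_inj w : injective (ev w).
Proof. by move=> i j /valz_inj/perm_inj[]. Qed.

Lemma eq_ev w u : ev w =1 ev u -> w = u.
Proof.
move=> e; apply/val_inj/permP => -[i b].
have ei : sgval w (posl i) = sgval u (posl i) by apply/valz_inj/e.
case: b => //; have -> : (i, true) = oppl (posl i) by [].
by rewrite !sgval_oppl ei.
Qed.

Lemma abs_ev_inj w : injective (fun i => `|ev w i|).
Proof.
move=> i j e; have [/ev_inj // | evN] : ev w i = ev w j \/ ev w i = (- ev w j)%R by lia.
by move: evN; rewrite /ev -valz_oppl -sgval_oppl => /valz_inj/perm_inj[].
Qed.

(** Since w(-a) = - w(a), forgetting signs still yields a permutation. *)
Lemma absletter_inj w : injective (fun i => (sgval w (posl i)).1).
Proof. by move=> a b e; apply: (@abs_ev_inj w); rewrite /ev !absz_valz e. Qed.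

Definition absperm w : 'S_n := perm (@absletter_inj w).

Lemma absz_ev w i : `|ev w i| = (absperm w i).+1.
Proof. by rewrite /ev absz_valz permE. Qed.

Lemma card_abs_ev w i : #|[set j | `|ev w j| < `|ev w i|]| = `|ev w i|.-1.
Proof.
rewrite [in RHS]absz_ev -card_ltn_perm; apply: eq_card => j.
by rewrite !inE !absz_ev.
Qed.

Lemma ev1 i : ev (1 : SB n) i = (i.+1)%:Z%R.
Proof. by rewrite /ev /valz /= perm1 /= mul1r. Qed.

Lemma negsum_ev1 : negsum (ev (1 : SB n)) = 0.
Proof. by rewrite /negsum big1 // => i; rewrite ev1; lia. Qed.

Lemma ev_emb w v i : ev (compg w (emb v)) i = ev w (v i).
Proof. by rewrite /ev /compg /= permM permE. Qed.

Lemma ev_flip w i0 : ev (compg w (flip i0)) =1 negate_at i0 (ev w).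
Proof.
move=> i; rewrite /ev /negate_at /compg /= permM permE /=.
have [-> | ne_i] := eqVneq i i0; first by rewrite eqxx sgval_oppl valz_oppl.
by rewrite !xpair_eqE (negbTE ne_i).
Qed.

Lemma eq_statB w f : ev w =1 f -> statB w = invs f + negsum f.
Proof.
move=> wf; congr (_ + _); first by apply: eq_invs => i j; rewrite !wf.
by apply: eq_big => i; rewrite wf.
Qed.

Lemma statB_emb w v : statB (compg w (emb v)) = invs (ev w \o v) + negsum (ev w).
Proof. by rewrite (eq_statB (ev_emb w v)) negsum_comp. Qed.

(** Changing the sign of the first entry from c > 0 to - c removes the c - 1
    inversions with the entries of smaller absolute value, of which there is
    one for each of 1, ..., c - 1, and adds c to negsum. *)
Lemma statB_flip w i0 : i0 = 0 :> nat -> (0 < ev w i0)%R ->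
  statB (compg w (flip i0)) = (statB w).+1.
Proof.
move=> i0E pos; rewrite (eq_statB (ev_flip w i0)) /statB negsum_negate //.
by rewrite [in RHS](invs_negate _ i0E pos) ?card_abs_ev; [lia | apply: abs_ev_inj].
Qed.

Lemma flipK w i0 : compg (compg w (flip i0)) (flip i0) = w.
Proof.
by apply: eq_ev => i; rewrite ev_flip /negate_at ev_flip /negate_at; case: eqP; rewrite ?opprK.
Qed.

Lemma embK w v : compg (compg w (emb v)) (emb v^-1) = w.
Proof. by apply: eq_ev => i; rewrite !ev_emb permKV. Qed.

(** Multiplying by s_i swaps two adjacent entries and leaves negsum unchanged;
    multiplying by s_0 changes the sign of the first entry.  If no generator
    decreases the statistic, then the window is increasing with a positive
    first entry, hence is (1, ..., n). *)
Lemma lenB_statB w : lenB w = statB w.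
Proof.
move: w; apply: (@wlen_eq _ _ statB) => [|s w|w w1].
- rewrite /statB negsum_ev1 invs_increasing // => i j.
  by rewrite !ev1; lia.
- rewrite !inE => /orP[/imsetP[i0] | /imsetP[t /imsetP[[i j] + ->] ->]].
    rewrite inE => /eqP i0E ->.
    have [neg | pos | ev0] := ltgtP (ev w i0) 0%R.
    + rewrite -[in X in _ <= X](flipK w i0) [X in _ <= X.+1]statB_flip //.
        by lia.
      by rewrite ev_flip /negate_at eqxx; lia.
    + by rewrite statB_flip.
    + by have := absz_valz (sgval w (posl i0)); rewrite -/(ev w i0) ev0.
  rewrite inE /= => /eqP ij; rewrite statB_emb /statB -addSn leq_add2r.
  by apply: invs_swap_le => //; apply: ev_inj.
have [wI | [i [j [ij lt_ji]]]] := increasingVdescent (@ev_inj w); last first.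
  exists (emb (tperm i j)), (compg w (emb (tperm i j))); split.
  + rewrite inE; apply/orP; right; apply/imset_f/imsetP.
    by exists (i, j); rewrite ?inE //= ij.
  + by rewrite -{1}(embK w (tperm i j)) tpermV.
  + by rewrite statB_emb /statB ltn_add2r [X in _ < X](invs_swap_descent ij).
have [/forallP w_pos | /forallPn[i]] := boolP [forall i, (0 < ev w i)%R].
  have posE i : ev w i = (absperm w i).+1%:Z%R.
    by rewrite -absz_ev; have := w_pos i; lia.
  case/eqP: w1; apply: eq_ev => i; rewrite posE ev1 (_ : absperm w = 1) ?perm1 //.
  by apply: increasing_perm1 => j k /wI; rewrite !posE; lia.
rewrite -leNgt => neg_i.
pose i0 := Ordinal (leq_ltn_trans (leq0n i) (ltn_ord i)).
have neg0 : (ev w i0 < 0)%R.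
  have [-> | ne_i] := eqVneq i0 i.
    have := absz_ev w i; lia.
  have/wI : i0 < i by move: ne_i; rewrite -val_eqE /=; lia.
  lia.
exists (flip i0), (compg w (flip i0)); split.
- by rewrite inE; apply/orP; left; apply/imset_f; rewrite inE.
- by rewrite flipK.
- rewrite -[in X in _ < X](flipK w i0) [X in _ < X]statB_flip //.
  by rewrite ev_flip /negate_at eqxx; lia.
Qed.

(** * The parabolic factorization *)

(** Multiplying by s_i in J increases the length exactly when positions i and
    i + 1 carry an ascent. *)
Lemma minrepE w : reflect (increasing (ev w)) (w \in minrep n).
Proof.
rewrite inE; apply: (iffP forall_inP) => [w_min | wI _ /imsetP[t /imsetP[[i j] + ->] ->]].
  have [// | [i [j [ij lt_ji]]]] := increasingVdescent (@ev_inj w).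
  have tJ : emb (tperm i j) \in J n.
    by apply/imset_f/imsetP; exists (i, j); rewrite ?inE //= ij.
  have := w_min _ tJ; rewrite !lenB_statB statB_emb /statB ltn_add2r.
  by rewrite (invs_swap_descent ij lt_ji) ltnNge leqnSn.
rewrite inE /= => /eqP ij; rewrite !lenB_statB statB_emb /statB ltn_add2r.
by rewrite invs_swap // wI // ij.
Qed.

Lemma increasing_ltE (f : 'I_n -> int) i j : increasing f -> (f i < f j)%R = (i < j).
Proof.
move=> fI; case: (ltngtP i j) => [/fI // | /fI | /val_inj->]; last exact: ltxx.
by move=> lt_ji; apply/negbTE; rewrite -leNgt ltW.
Qed.

Lemma increasing_fact_exists w : exists u v, increasing (ev u) /\ w = compg u (emb v).
Proof.
have [v wvI] := sort_perm (@ev_inj w).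
exists (compg w (emb v)), v^-1; rewrite embK; split=> // i j ij.
by rewrite !ev_emb; apply: wvI.
Qed.

(** The factor v is the relative order of the entries of the window of u v,
    which therefore determines it, and u with it. *)
Lemma increasing_fact_inj u u' v v' : increasing (ev u) -> increasing (ev u') ->
  compg u (emb v) = compg u' (emb v') -> (u, v) = (u', v').
Proof.
move=> uI uI' e; have evv i : ev u (v i) = ev u' (v' i) by rewrite -!ev_emb e.
have vv : v^-1 * v' = 1.
  apply: increasing_perm1 => i j ij; rewrite !permM -(increasing_ltE _ _ uI').
  by rewrite -!evv !permKV increasing_ltE.
have {}vv : v = v' by rewrite -[v]mulg1 -vv mulKVg.
by congr (_, _) => //; apply: eq_ev => i; rewrite -(permKV v i) evv vv.
Qed.

Lemma lenB_fact u v : increasing (ev u) ->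
  lenB (compg u (emb v)) = negsum (ev u) + lenA v.
Proof.
move=> uI; rewrite lenB_statB statB_emb lenA_invs addnC; congr (_ + _).
by apply: eq_invs => i j; rewrite /= increasing_ltE.
Qed.

Lemma parabolic_pairE u v : increasing (ev u) ->
  parabolic_pair (compg u (emb v)) = (u, v).
Proof.
move=> uI; rewrite /parabolic_pair.
case: pickP => [[u' v'] /and3P[/eqP/= e /minrepE uI' _] | /(_ (u, v)) /negP[]].
  by apply: increasing_fact_inj.
apply/and3P; split=> //=; first exact/minrepE.
have lenB_u : lenB u = negsum (ev u) by rewrite lenB_statB /statB invs_increasing.
have lenB_v : lenB (emb v) = lenA v.
  rewrite -[emb v]mulg1 -[_ * 1]/(compg 1 (emb v)) lenB_fact ?negsum_ev1 //.
  by move=> i j; rewrite !ev1; lia.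
by rewrite lenB_fact // lenB_u lenB_v.
Qed.

(** * The negative major index *)

Lemma eq_maj (f g : 'I_n -> int) : same_order f g ->
  maj [seq f i | i : 'I_n] = maj [seq g i | i : 'I_n].
Proof.
move=> fg; rewrite /maj !size_map -!enumT size_enum_ord.
rewrite [LHS]big_nat_cond [RHS]big_nat_cond; apply: eq_bigl => i.
have [/andP[i_gt0 i_lt] /= | //] := boolP (1 <= i < n).
have nthE (h : 'I_n -> int) k (kn : k < n) :
    nth (0 : int)%R [seq h i | i : 'I_n] k = h (Ordinal kn).
  rewrite (nth_map (Ordinal kn)) -?enumT ?size_enum_ord //; congr h.
  by apply: val_inj; rewrite /= nth_enum_ord.
have i1_lt : i.-1 < n by lia.
by rewrite !(nthE _ _ i_lt) !(nthE _ _ i1_lt) fg.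
Qed.

Lemma nmaj_fact u v : increasing (ev u) ->
  nmaj (compg u (emb v)) = (maj (windowA v) + negsum (ev u))%:Z%R.
Proof.
move=> uI; rewrite /nmaj PoszD; congr (_ + _)%R.
  congr Posz; apply: eq_maj => i j.
  by rewrite !ev_emb increasing_ltE //; lia.
rewrite -(negsum_comp _ v) -negsumE; congr (- _)%R.
by apply: eq_big => i; rewrite ?inE ev_emb.
Qed.

End Signed.

Theorem corollary5p2 (n : nat) (hn : (2 <= n)%N)
    (inv : 'S_n -> 'S_n) (invK : involutive inv)
    (maj_len : forall v : 'S_n, maj (windowA v) = lenA (inv v)) :
  exists invB : SB n -> SB n,
    [/\ involutive invB,
        forall s : SB n, nmaj s = (lenB (invB s))%:Z%R
      & forall s : SB n, invB s = compg (PJ s) (emb (inv (partJ s)))].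
Proof.
exists (fun s => compg (PJ s) (emb (inv (partJ s)))).
have invE u v : increasing (ev u) ->
    compg (PJ (compg u (emb v))) (emb (inv (partJ (compg u (emb v))))) =
    compg u (emb (inv v)).
  by move=> uI; rewrite /PJ /partJ parabolic_pairE.
split=> // s; have [u [v [uI ->]]] := increasing_fact_exists s.
  by rewrite (invE u v uI) (invE u (inv v) uI) invK.
by rewrite invE // nmaj_fact // lenB_fact // maj_len addnC.
Qed.
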